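(* Let $n\ge2$. There is a unimodular triangulation of $\Delta^n$ whose simplicial complex is combinatorially isomorphic to a triple cone over the bipermutahedral fan $\Sigma_{n,n}$; that is, isomorphic to the simplicial complex with vertex set $\{\text{rays of }\Sigma_{n,n}\}\sqcup\{a,b,c\}$ whose faces are the sets $R\cup A$ with $R$ the set of rays of a cone of $\Sigma_{n,n}$ and $A\subseteq\{a,b,c\}$.
   Context: Let $\mathsf{e},\mathsf{f},\mathsf{g}$ be the standard basis of $\mathbb{R}^3$, $\Delta=\mathrm{conv}(\mathsf{e},\mathsf{f},\mathsf{g})$, and $\Delta^n=\Delta\times\cdots\times\Delta\subset\mathbb{R}^{3\times n}$ ($n$ factors). A triangulation of $\Delta^n$ is unimodular if all its simplices have vertices in $\mathbb{Z}^{3n}$ and each full-dimensional simplex has edge vectors from a vertex forming a basis of the lattice $\mathbb{Z}^{3n}$ intersected with the linear span parallel to the affine hull of $\Delta^n$. Let $N_n=\mathbb{R}^n/\mathbb{R}(1,\dots,1)$; for $S\subseteq[n]$ let $\mathsf{e}_S,\mathsf{f}_S$ be the images in the first, second factor of $N_n\times N_n$ of the indicator vector of $S$. A bipermutation of $[n]$ is a sequence $b_1|\cdots|b_{2n-1}$ of elements of $[n]$ in which one element appears exactly once and every other element exactly twice. The bipermutahedral fan $\Sigma_{n,n}$ is the complete simplicial fan in $N_n\times N_n$ whose maximal cones are $\mathrm{cone}\{\mathsf{e}_{\{b_1,\dots,b_m\}}+\mathsf{f}_{\{b_{m+1},\dots,b_{2n-1}\}}:1\le m\le 2n-2\}$ for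 the bipermutations, together with all their faces. *)

(* Defs.v *)
From HB Require Import structures.
From mathcomp Require Import all_boot all_order all_algebra finmap.
From mathcomp Require Import generic_quotient ring_quotient.
From mathcomp Require Import boolp classical_sets functions reals.

Set Implicit Arguments.
Unset Strict Implicit.
Unset Printing Implicit Defensive.

Import Order.TTheory GRing.Theory Num.Theory.
Local Open Scope classical_set_scope.
Local Open Scope ring_scope.
Local Open Scope quotient_scope.

Definition conv_hull (R : realType) (V : lmodType R) (s : {fset V}) : set V :=
  [set x | exists c : V -> R, [/\ forall v, v \in s -> 0 <= c v,
     \sum_(v <- s) c v = 1 & x = \sum_(v <- s) c v *: v]].

Definition aff_hull (R : realType) (V : lmodType R) (P : set V) : set V :=
  [set x | exists (s : {fset V}) (c : V -> R), [/\ [set` s] `<=` P,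
     \sum_(v <- s) c v = 1 & x = \sum_(v <- s) c v *: v]].

Definition aff_indep (R : realType) (V : lmodType R) (s : {fset V}) : Prop :=
  forall c : V -> R, \sum_(v <- s) c v = 0 -> \sum_(v <- s) c v *: v = 0 ->
  forall v, v \in s -> c v = 0.

(* A simplex is given by its finite set of vertices; the empty simplex is
   allowed, and belongs to every triangulation of a nonempty set. *)
Record triangulation (R : realType) (V : lmodType R)
    (P : set V) (K : {fset {fset V}}) : Prop := Triangulation {
  tri_simplex : forall s, s \in K -> aff_indep s;
  tri_face : forall s t : {fset V}, s \in K -> (t `<=` s)%fset -> t \in K;
  tri_inter : forall s t, s \in K -> t \in K ->
    exists u : {fset V}, [/\ (u `<=` s)%fset, (u `<=` t)%fset &
                             conv_hull s `&` conv_hull t = conv_hull u];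
  tri_cover : \bigcup_(s in [set` K]) conv_hull s = P }.

Definition lattice_basis (V : zmodType) (L : set V) (B : {fset V}) : Prop :=
  [set` B] `<=` L /\
  forall w, L w -> exists! c : {ffun B -> int}, w = \sum_(b : B) val b *~ c b.

(* The integral matrices in the linear space parallel to [aff_hull P]. *)
Definition parallel_lattice (R : realType) (k n : nat)
    (P : set 'M[R]_(k, n)) : set 'M[R]_(k, n) :=
  [set w | w \is a mxOver Num.int /\
           exists x y, [/\ aff_hull P x, aff_hull P y & w = x - y]].

(* The affine hull of a simplex of a triangulation of [P] is contained in that
   of [P], with equality exactly when the simplex is full-dimensional. *)
Definition unimodular (R : realType) (k n : nat)
    (P : set 'M[R]_(k, n)) (K : {fset {fset 'M[R]_(k, n)}}) : Prop :=
  (forall s v, s \in K -> v \in s -> v \is a mxOver Num.int) /\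
  (forall s, s \in K -> aff_hull [set` s] = aff_hull P ->
   forall v, v \in s ->
   lattice_basis (parallel_lattice P)
     [fset (u - v)%R | u in (s `\ v)%fset]%fset).

Definition triangle (R : realType) : set 'cV[R]_3 :=
  conv_hull [fset delta_mx i 0 | i in 'I_3]%fset.

Arguments triangle R : clear implicits.

Definition triangle_power (R : realType) (n : nat) : set 'M[R]_(3, n) :=
  [set x | forall j, triangle R (col j x)].

Arguments triangle_power R n : clear implicits.

Definition cone (R : realType) (W : lmodType R) (G : {fset W}) : set W :=
  [set x | exists2 c : W -> R, (forall g, g \in G -> 0 <= c g) &
     x = \sum_(g <- G) c g *: g].

Definition cone_face (R : realType) (W : lmodType R) (F C : set W) : Prop :=
  exists l : {scalar W}, (forall x, C x -> 0 <= l x) /\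
    F = C `&` [set x | l x = 0].

Definition is_ray (R : realType) (W : lmodType R) (C : set W) : Prop :=
  exists2 w : W, w != 0 & C = cone [fset w]%fset.

Definition rays_of (R : realType) (W : lmodType R) (C : set W) : set (set W) :=
  [set r | is_ray r /\ cone_face r C].

(* The library quotients zmodules and rings only; here the quotient of a
   vector space by a subspace is made a vector space again. *)
Definition quotv (R : realType) (V : vectType R) (U : {vspace V}) : Type :=
  @Quotient.quot V (pred_of_vspace U).

HB.instance Definition _ (R : realType) (V : vectType R) (U : {vspace V}) :=
  GRing.Zmodule.on (quotv U).
HB.instance Definition _ (R : realType) (V : vectType R) (U : {vspace V}) :=
  EqQuotient.on (quotv U).

Definition quotv_scale (R : realType) (V : vectType R) (U : {vspace V})
  (a : R) (x : quotv U) : quotv U := \pi_(quotv U) (a *: repr x).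

Section QuotientScale.
Context (R : realType) (V : vectType R) (U : {vspace V}).

Lemma pi_quotv_eq (x y : V) :
  (\pi_(quotv U) x == \pi_(quotv U) y) = (x - y \in U).
Proof. by rewrite (Quotient.idealrBE (pred_of_vspace U)). Qed.

Lemma pi_quotvZ (a : R) (x : V) :
  quotv_scale a (\pi_(quotv U) x) = \pi_(quotv U) (a *: x).
Proof.
apply/eqP; rewrite /quotv_scale pi_quotv_eq -scalerBr rpredZ //.
by rewrite -pi_quotv_eq reprK.
Qed.

Lemma pi_quotvD (x y : V) :
  \pi_(quotv U) x + \pi_(quotv U) y = \pi_(quotv U) (x + y).
Proof. by rewrite !piE. Qed.

Lemma quotv_scalerA (a b : R) (x : quotv U) :
  quotv_scale a (quotv_scale b x) = quotv_scale (a * b) x.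
Proof.
by elim/quotW: x => x; rewrite (pi_quotvZ b) !pi_quotvZ scalerA.
Qed.

Lemma quotv_scale1r : left_id 1 (@quotv_scale R V U).
Proof. by elim/quotW => x; rewrite pi_quotvZ scale1r. Qed.

Lemma quotv_scalerDr : right_distributive (@quotv_scale R V U) +%R.
Proof.
move=> a; elim/quotW => x; elim/quotW => y.
by rewrite pi_quotvD !pi_quotvZ pi_quotvD scalerDr.
Qed.

Lemma quotv_scalerDl (x : quotv U) :
  {morph (@quotv_scale R V U)^~ x : a b / a + b}.
Proof.
by elim/quotW: x => x a b; rewrite !pi_quotvZ pi_quotvD scalerDl.
Qed.

HB.instance Definition _ := GRing.Zmodule_isLmodule.Build R (quotv U)
  quotv_scalerA quotv_scale1r quotv_scalerDr quotv_scalerDl.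

End QuotientScale.

Definition Nspace (R : realType) (n : nat) : Type :=
  quotv <[const_mx 1 : 'rV[R]_n]>%VS.

HB.instance Definition _ (R : realType) (n : nat) :=
  GRing.Lmodule.on (Nspace R n).

Definition indic (R : realType) (n : nat) (S : {set 'I_n}) : Nspace R n :=
  \pi_(quotv <[const_mx 1 : 'rV[R]_n]>%VS) (\row_i (i \in S)%:R).

Definition evec (R : realType) (n : nat) (S : {set 'I_n}) :
  (Nspace R n * Nspace R n)%type := (indic R S, 0).

Definition fvec (R : realType) (n : nat) (S : {set 'I_n}) :
  (Nspace R n * Nspace R n)%type := (0, indic R S).

Definition bipermutation (n : nat) (b : (n.*2.-1).-tuple 'I_n) : Prop :=
  exists i, count_mem i b = 1%N /\
            forall j, j != i -> count_mem j b = 2%N.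

(* Positions are 1-based in the mathematics: b_1, ..., b_m is [take m b]. *)
Definition biperm_rays (R : realType) (n : nat) (b : (n.*2.-1).-tuple 'I_n) :
    {fset Nspace R n * Nspace R n} :=
  [fset (evec R [set i in take m b] + fvec R [set i in drop m b])%R
     | m in iota 1 n.*2.-2]%fset.

Definition biperm_fan (R : realType) (n : nat) :
    set (set (Nspace R n * Nspace R n)) :=
  [set F | exists2 b : (n.*2.-1).-tuple 'I_n, bipermutation b &
     cone_face F (cone (biperm_rays R b))].

Arguments biperm_fan R n : clear implicits.

(* A simplicial complex is given by its set of vertices [A] and its set of
   faces [K], which are subsets of [A]. *)
Definition complex_iso (T U : Type)
    (A : set T) (K : set (set T)) (B : set U) (L : set (set U)) : Prop :=
  exists f : T -> U, set_bij A B f /\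
    forall S, S `<=` A -> (K S <-> L (f @` S)).

Definition tri_vertices (V : choiceType) (K : {fset {fset V}}) : set V :=
  [set v | exists2 s, s \in K & v \in s].

Definition tri_faces (V : choiceType) (K : {fset {fset V}}) : set (set V) :=
  [set S | exists2 s, s \in K & S = [set` s]].

Definition triple_cone_vertices (R : realType) (W : lmodType R)
    (Sigma : set (set W)) : set (set W + 'I_3) :=
  [set v | match v with inl r => is_ray r /\ Sigma r | inr _ => True end].

Definition triple_cone_faces (R : realType) (W : lmodType R)
    (Sigma : set (set W)) : set (set (set W + 'I_3)) :=
  [set F | exists C (A : set 'I_3), Sigma C /\
     F = [set inl r | r in rays_of C] `|` [set inr a | a in A]].

(* Main.v *)
(** Vertices of Delta^n are the maps [v : [n] -> {0, 1, 2}], where [0], [1], [2]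
    stand for f, g, e. The simplices are the sets of vertices which, after the
    constant map [1] has been removed, form a chain for the coordinatewise order
    and admit an index [k] at which no vertex takes the value [1].

    Let [x] be a convex combination over such a set. The partial sums of the
    coefficients along the chain are the numbers [x_(f,i)] and [L - x_(e,i)],
    where [L = max_i (x_(f,i) + x_(e,i))] is attained at [k] and is the total
    weight of the chain. So sorting these numbers recovers the simplex and the
    coefficients from [x], which gives the covering and intersection properties;
    and the coefficients are integral combinations of the entries of [x], which
    gives unimodularity.

    A bipermutation [b] gives the maximal chain whose [m]-th member sends [i] to
    [0], [1] or [2] according as none, some or all of its occurrences are among
    [b_1, ..., b_m], its once-occurring element being [k]. Every simplex extends
    to such a chain, and the nonconstant member [v] corresponds to the ray of
    [e_{v <> 0} + f_{v <> 2}]. These rays have dual functionals, so the faces of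
    a maximal cone of the fan are the cones over arbitrary subsets of its rays.
    The three constant maps are the cone points. *)
Require Import Defs.
From HB Require Import structures.
From mathcomp Require Import generic_quotient.
From mathcomp Require Import boolp classical_sets functions reals.
From mathcomp Require Import all_boot all_order all_algebra finmap.
From mathcomp Require Import ring lra zify.

Set Implicit Arguments.
Unset Strict Implicit.
Unset Printing Implicit Defensive.

Import Order.TTheory GRing.Theory Num.Theory.
Local Open Scope ring_scope.

(** * The chains of vertices and their convex combinations *)

Definition vert n := {ffun 'I_n -> 'I_3}.

Section Vertices.
Context {n : nat}.
Implicit Types (u v w : vert n) (s t : {set vert n}).

Definition corner (j : 'I_3) : vert n := [ffun=> j].

Definition lev u v := [forall i, (u i <= v i)%N].

Definition special s := [/\ exists k, forall u, u \in s -> u != corner 1 -> u k != 1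
  & forall u v, u \in s -> v \in s -> u != corner 1 -> v != corner 1 -> lev u v || lev v u].

Lemma I3P (j : 'I_3) : [\/ j = 0, j = 1 | j = ord_max].
Proof.
case: j => [[|[|[|//]]] p]; [apply: Or31|apply: Or32|apply: Or33]; exact: val_inj.
Qed.

Lemma lev_refl u : lev u u.
Proof. by apply/forallP. Qed.

Lemma lev_trans v u w : lev u v -> lev v w -> lev u w.
Proof.
by move=> /forallP uv /forallP vw; apply/forallP => i; apply: leq_trans (vw i).
Qed.

Lemma lev_anti u v : lev u v -> lev v u -> u = v.
Proof.
move=> /forallP uv /forallP vu; apply/ffunP => i; apply/val_inj/eqP.
by rewrite eqn_leq uv vu.
Qed.

Lemma special_sub s t : s \subset t -> special t -> special s.
Proof.
move=> /fintype.subsetP st [[k kP] tP]; split; first by exists k => u /st; apply: kP.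
by move=> u v /st ut /st vt; apply: tP.
Qed.

(** Nonnegative differences [u i - v i] whose sum is at most zero all vanish. So along a chain the
    coordinate sum decides the order, and its extrema give the ends of the chain. *)
Lemma lev_rank u v : lev u v || lev v u -> (\sum_i u i <= \sum_i v i)%N -> lev u v.
Proof.
case/orP => // vu uv.
have e i : v i = u i :> nat.
  have : (\sum_i (u i - v i) == 0)%N.
    by rewrite sumnB ?subn_eq0// => j _; exact: (forallP vu).
  rewrite sum_nat_eq0 => /forallP/(_ i)/=; rewrite subn_eq0 => uvi.
  by apply/eqP; rewrite eqn_leq uvi (forallP vu).
by apply/forallP => i; rewrite e.
Qed.

Lemma chain_max s u0 : u0 \in s ->
    (forall u v, u \in s -> v \in s -> lev u v || lev v u) ->
  exists2 a, a \in s & forall w, w \in s -> lev w a.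
Proof.
move=> u0s ch; have [a as_ amax] := @arg_maxnP _ u0 [in s] (fun u => \sum_i u i)%N u0s.
by exists a => // w ws; apply: lev_rank; [exact: ch | exact: amax].
Qed.

Lemma chain_min s u0 : u0 \in s ->
    (forall u v, u \in s -> v \in s -> lev u v || lev v u) ->
  exists2 a, a \in s & forall w, w \in s -> lev a w.
Proof.
move=> u0s ch; have [a as_ amin] := @arg_minnP _ u0 [in s] (fun u => \sum_i u i)%N u0s.
by exists a => // w ws; apply: lev_rank; [exact: ch | exact: amin].
Qed.

(** * Weights on the vertices and their marginals *)

Section Coefficients.
Context (R : realType).
Implicit Types (c d : vert n -> R) (i : 'I_n) (j : 'I_3).

(** For the weights of a convex combination this is the law of the [i]-th coordinate; it is the
    entry [(j, i)] of the matrix [comb c] below. *)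
Definition marginal c i j := \sum_(u : vert n | u i == j) c u.

Lemma sum_marginal c i : \sum_u c u = \sum_j marginal c i j.
Proof. by rewrite (partition_big (fun u : vert n => u i) xpredT). Qed.

Lemma sum_marginal3 c i : \sum_u c u = marginal c i 0 + marginal c i 1 + marginal c i ord_max.
Proof.
rewrite (sum_marginal _ i) !big_ord_recl big_ord0 addr0 addrA;
congr (_ + marginal _ _ _ + marginal _ _ _);
exact: val_inj.
Qed.

(** The zero subgroup as a closed predicate: with it, [special_coef] also yields linear
    independence, in the form of [special_coef0]. *)
Definition zero_pred := pred1 (0 : R).

Lemma zero_zmod : zmod_closed zero_pred.
Proof.
by split=> [|u v]; rewrite !inE // => /eqP-> /eqP->; rewrite subr0.
Qed.

HB.instance Definition _ := GRing.isZmodClosed.Build R zero_pred zero_zmod.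

(* Along the chain every partial sum of the coefficients is [marginal c i 0], or
   the total minus [marginal c i 2], for some [i]: two consecutive vertices
   differ at some [i], where the lower one is [0] or the upper one is [2]. *)
Lemma special_coef (Z : zmodClosed R) s c : special s ->
    (forall u, u \notin s -> c u = 0) ->
    (forall i j, marginal c i j \in Z) -> forall u, c u \in Z.
Proof.
move=> [[k kP] ch] c0 cZ.
pose s' := s :\ corner 1.
have c0' u : u \notin s' -> u != corner 1 -> c u = 0.
  by rewrite !inE negb_and negbK => /orP[/eqP->|/c0//]; rewrite eqxx.
have chs u v : u \in s' -> v \in s' -> lev u v || lev v u.
  by rewrite !inE => /andP[u1 us] /andP[v1 vs]; exact: ch.
have k1 u : u \in s' -> u k != 1 by rewrite !inE => /andP[u1 us]; exact: kP.
have corner1E i j : (corner 1 i == j) = (j == 1) by rewrite ffunE eq_sym.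
have marginalE i j : j != 1 -> marginal c i j = \sum_(u in s' | u i == j) c u.
  move=> j1; rewrite /marginal [LHS](bigID [in s']) /= [X in _ + X]big1 ?addr0.
    by apply: eq_bigl => u; rewrite andbC.
  move=> u /andP[ui us]; apply: c0' => //.
  by apply: contraTneq ui => ->; rewrite corner1E.
(* At [k] the members of [s'] take only the values 0 and 2, so their total weight is a sum of two
   marginals. *)
have LZ : \sum_(u in s') c u \in Z.
  rewrite (bigID (fun u : vert n => u k == 0)) /= -marginalE// rpredD//.
  rewrite (eq_bigl (fun u : vert n => (u \in s') && (u k == ord_max))).
    by rewrite -marginalE.
  move=> u /=; have [/k1|//] := boolP (u \in s').
  by case: (I3P (u k)) => -> /=.
(* [X] is an initial segment of the chain; below, [a] is its top and [b] the bottom of the rest. *)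
have XZ (X : {set vert n}) : X \subset s' ->
    (forall u v, u \in X -> v \in s' :\: X -> lev u v) -> \sum_(u in X) c u \in Z.
  move=> /fintype.subsetP Xs XP.
  have [->|[u0 u0X]] := set_0Vmem X; first by rewrite big_set0 rpred0.
  have [e|[v0 v0X]] := set_0Vmem (s' :\: X).
    rewrite (_ : X = s') //; apply/setP => u; apply/idP/idP; first exact: Xs.
    by move=> us; move/setP/(_ u): e; rewrite in_setD us andbT inE => /negbFE.
  have [a aX amax] := chain_max u0X (fun u v uX vX => chs u v (Xs _ uX) (Xs _ vX)).
  have [|b bX bmin] := chain_min v0X.
    by move=> u v /setDP[us _] /setDP[vs _]; exact: chs.
  have ab := XP _ _ aX bX.
  have [i abi] : exists i, (a i < b i)%N.
    apply/existsP; apply: contraTT bX; rewrite negb_exists => /forallP ba.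
    rewrite (_ : b = a) ?in_setD ?aX//; apply: lev_anti => //.
    by apply/forallP => i; rewrite leqNgt.
  case: (I3P (a i)) => ai.
  (* Here [a i] is 0 and [b i] is positive, so [X] consists of the members that vanish at [i]. *)
  - rewrite (eq_bigl (fun u : vert n => (u \in s') && (u i == 0))) -?marginalE//.
    move=> u /=; apply/idP/andP => [uX|[us /eqP ui]].
      split; first exact: Xs.
      by have /forallP/(_ i) := amax _ uX; rewrite ai leqn0.
    apply: contraTT (abi) => uX; rewrite -leqNgt.
    have /forallP/(_ i) : lev b u by apply: bmin; rewrite in_setD uX us.
    by rewrite ui leqn0 => /eqP->.
  (* Here [a i] is 1 and [b i] is 2, so the members outside [X] are those with value 2 at [i]. *)
  - have bi : b i = ord_max by case: (I3P (b i)) abi => ->; rewrite ai.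
    rewrite (_ : \sum_(u in X) c u = \sum_(u in s') c u - \sum_(u in s' | u i == ord_max) c u).
      by rewrite rpredB// -marginalE.
    rewrite [X in _ = X - _](bigID (fun u : vert n => u i == ord_max)) /= addrAC subrr add0r.
    apply: eq_bigl => u /=; apply/idP/andP => [uX|[us ui]].
      split; first exact: Xs.
      by have /forallP/(_ i) := amax _ uX; rewrite ai; case: (I3P (u i)) => ->.
    apply: contraR ui => uX.
    have /forallP/(_ i) : lev b u by apply: bmin; rewrite in_setD uX us.
    by rewrite bi; case: (I3P (u i)) => ->.
  - by move: abi; rewrite ai ltnNge -ltnS ltn_ord.
(* A single coefficient is the difference of the sums over two consecutive initial segments. *)
have sZ u : u \in s' -> c u \in Z.
  move=> us; have -> : c u = \sum_(w in [set w in s' | lev w u]) c w -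
      \sum_(w in [set w in s' | lev w u && (w != u)]) c w.
    apply/eqP; rewrite eq_sym subr_eq (bigD1 u) /=; last by rewrite inE us lev_refl.
    by apply/eqP; congr (_ + _); apply: eq_bigl => w; rewrite !inE andbA.
  rewrite rpredB// XZ//; try by apply/fintype.subsetP => w; rewrite inE => /andP[].
  - move=> w v; rewrite !inE => /andP[ws wu] /and3P[+ v1 vs]; rewrite v1 vs /= => vu.
    have vs' : v \in s' by rewrite !inE v1.
    have := chs _ _ us vs'; rewrite (negPf vu) orbF; exact: lev_trans.
  - move=> w v; rewrite !inE => /and3P[ws wu _] /and3P[+ v1 vs]; rewrite v1 vs /=.
    have vs' : v \in s' by rewrite !inE v1.
    rewrite negb_and negbK => /orP[vu|/eqP-> //].
    have := chs _ _ us vs'; rewrite (negPf vu) orbF; exact: lev_trans.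
move=> u; have [us|] := boolP (u \in s'); first exact: sZ.
have [-> _|u1 /c0'->//] := eqVneq u (corner 1); last exact: rpred0.
rewrite (_ : c _ = \sum_u c u - \sum_(u in s') c u).
  by rewrite rpredB// (sum_marginal _ k) rpred_sum.
rewrite [X in X - _](bigID [in s']) /= addrAC subrr add0r (bigD1 (corner 1)) ?inE ?eqxx//=.
by rewrite big1 ?addr0// => v /andP[vs v1]; exact: c0'.
Qed.

Lemma special_coef0 s c : special s ->
    (forall u, u \notin s -> c u = 0) ->
    (forall i j, marginal c i j = 0) -> forall u, c u = 0.
Proof.
move=> sp c0 cz u; apply/eqP.
by apply: (@special_coef zero_pred s) => // i j; rewrite inE cz.
Qed.

Definition supp c := [set u | c u != 0].

Lemma ler_sum_supp c (P Q : pred (vert n)) : (forall u, 0 <= c u) ->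
    (forall u, P u -> u \in supp c -> Q u) ->
  \sum_(u | P u) c u <= \sum_(u | Q u) c u.
Proof.
move=> c0 PQ; rewrite [leLHS]big_mkcond [leRHS]big_mkcond; apply: ler_sum => u _.
case: ifP => [/PQ|_]; last by case: ifP.
by rewrite inE; have [->|_ ->//] := eqVneq (c u) 0; rewrite if_same.
Qed.

(** With the next two lemmas: the weight of [corner 1] is the least of the numbers [marginal c i 1],
    and it is attained exactly at the indices admissible in [special]. Both are thus determined by
    the marginals. *)
Lemma marginal_apex c k : (forall u, 0 <= c u) ->
    (forall u, u \in supp c -> u != corner 1 -> u k != 1) -> marginal c k 1 = c (corner 1).
Proof.
move=> c0 kP; rewrite /marginal (bigD1 (corner 1)) /=; last by rewrite ffunE.
rewrite big1 ?addr0// => u /andP[uk u1]; apply/eqP/negPn/negP => cu.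
by have := kP u; rewrite inE cu u1 uk => /(_ isT isT).
Qed.

Lemma le_marginal_apex c i : (forall u, 0 <= c u) -> c (corner 1) <= marginal c i 1.
Proof.
by move=> c0; rewrite /marginal (bigD1 (corner 1)) ?ffunE//= lerDl sumr_ge0.
Qed.

Lemma marginal_apexN c k : (forall u, 0 <= c u) -> marginal c k 1 = c (corner 1) ->
  forall u, u \in supp c -> u != corner 1 -> u k != 1.
Proof.
move=> c0; rewrite /marginal (bigD1 (corner 1)) /=; last by rewrite ffunE.
move/eqP; rewrite -subr_eq0 addrAC subrr add0r psumr_eq0// => /allP h u.
rewrite inE => cu u1; apply: contra cu => uk.
by have := h u (mem_index_enum _); rewrite uk u1.
Qed.

(* Listing a chain in increasing order and placing intervals of lengths [c u]
   end to end, the interval of [u] ends before that of [v] starts. *)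
Lemma interval_le c d i u v :
    (forall w, 0 <= c w) -> (forall w, 0 <= d w) ->
    special (supp d) -> (forall i j, marginal c i j = marginal d i j) ->
    c (corner 1) = d (corner 1) -> v \in supp d -> v != corner 1 -> (u i < v i)%N ->
  \sum_(w | (w != corner 1) && lev w u) c w <=
  \sum_(w | (w != corner 1) && lev w v) d w - d v.
Proof.
move=> c0 d0 [_ ch] cd cd1 vd v1 uv.
rewrite [X in _ <= X - _](bigD1 v) /=; last by rewrite v1 lev_refl.
rewrite addrAC subrr add0r.
have tot : \sum_(w | w != corner 1) c w = \sum_(w | w != corner 1) d w.
  apply: (addrI (c (corner 1))); rewrite [in RHS]cd1 -!(bigD1 (corner 1) (P := xpredT))//.
  by rewrite !(sum_marginal _ i); apply: eq_bigr => j _; exact: cd.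
have chd w : w != corner 1 -> w \in supp d -> ~~ lev v w -> lev w v.
  by move=> w1 wd vw; have := ch _ _ vd wd v1 w1; rewrite (negPf vw).
case: (I3P (u i)) => ui.
(* Everything below [u] is 0 at [i], and the members of [supp d] that are 0 at [i] lie strictly
   below [v]. *)
- apply: (@le_trans _ _ (marginal c i 0)).
    apply: ler_sum_supp => // w /andP[_ /forallP/(_ i)]; rewrite ui => wi _.
    by rewrite -val_eqE -leqn0.
  rewrite cd; apply: ler_sum_supp => // w /eqP wi wd.
  have w1 : w != corner 1 by apply/eqP => e; move: wi; rewrite e ffunE.
  have vw : ~~ lev v w.
    by apply/negP => /forallP/(_ i); rewrite wi leqNgt (leq_ltn_trans _ uv).
  by rewrite w1 chd//=; apply: contraNneq vw => ->; exact: lev_refl.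
(* Passing to complements: the members of [supp d] not strictly below [v] are 2 at [i], and nothing
   that is 2 at [i] lies below [u]. *)
- have vi : v i = ord_max by case: (I3P (v i)) uv => ->; rewrite ui.
  rewrite -lerN2 -(lerD2l (\sum_(w | w != corner 1) c w)) [in leLHS]tot.
  rewrite [X in X - _](bigID (fun w => lev w v && (w != v))) /=.
  rewrite [X in _ <= X - _](bigID (lev^~ u)) /=.
  under [X in (X + _) - _ <= _]eq_bigl do rewrite andbA.
  rewrite ![_ + _ - _]addrAC !subrr !add0r.
  apply: (@le_trans _ _ (marginal d i ord_max)); last first.
    rewrite -cd; apply: ler_sum_supp => // w /eqP wi _.
    rewrite (_ : w != _); last by apply/eqP => e; move: wi; rewrite e ffunE.
    by apply/negP => /forallP/(_ i); rewrite wi ui.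
  apply: ler_sum_supp => // w /andP[w1]; rewrite negb_and negbK => h wd.
  suff /forallP/(_ i) : lev v w by rewrite vi; case: (I3P (w i)) => ->.
  case/orP: h => [wv|/eqP-> //]; last exact: lev_refl.
  by have := ch _ _ vd wd v1 w1; rewrite (negPf wv) orbF.
- by move: uv; rewrite ui ltnNge -ltnS ltn_ord.
Qed.

(** If [u] and [v] were incomparable, [interval_le] would apply in both directions, and each of two
    intervals of positive length would end before the other starts. *)
Lemma special_union c d :
    (forall w, 0 <= c w) -> (forall w, 0 <= d w) ->
    special (supp c) -> special (supp d) ->
    (forall i j, marginal c i j = marginal d i j) ->
  special (supp c :|: supp d).
Proof.
move=> c0 d0 cs ds cd; have [[k kc] chc] := cs; have [[l ld] chd] := ds.
have cd1 : c (corner 1) = d (corner 1).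
  apply/eqP; rewrite eq_le -{2}(marginal_apex c0 kc) -{1}(marginal_apex d0 ld) cd -cd.
  by rewrite !le_marginal_apex.
have cross u v : u \in supp c -> v \in supp d -> u != corner 1 -> v != corner 1 ->
    lev u v || lev v u.
  move=> uc vd u1 v1; rewrite -[_ || _]negbK negb_or !negb_forall; apply/negP => /andP[].
  case/existsP => i; rewrite -ltnNge => vui /existsP[j]; rewrite -ltnNge => uvj.
  have h1 := interval_le c0 d0 ds cd cd1 vd v1 uvj.
  have h2 := interval_le d0 c0 cs (fun i j => esym (cd i j)) (esym cd1) uc u1 vui.
  have : 0 < c u by rewrite lt0r c0 andbT; move: uc; rewrite inE.
  have : 0 < d v by rewrite lt0r d0 andbT; move: vd; rewrite inE.
  by move: h1 h2; lra.
split.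
  exists k => u /setUP[/kc//|]; apply: (marginal_apexN d0).
  by rewrite -cd -cd1 marginal_apex.
move=> u v /setUP[us|us] /setUP[vs|vs] u1 v1.
- exact: chc.
- exact: cross.
- by rewrite orbC cross.
- exact: chd.
Qed.

(** The difference [c - d] has zero marginals and is supported on a special set, by [special_union].
    This is what makes the simplices intersect properly. *)
Lemma marginal_inj c d :
    (forall w, 0 <= c w) -> (forall w, 0 <= d w) ->
    special (supp c) -> special (supp d) ->
    (forall i j, marginal c i j = marginal d i j) -> forall u, c u = d u.
Proof.
move=> c0 d0 cs ds cd u; apply/eqP; rewrite -subr_eq0; apply/eqP.
apply: (special_coef0 (c := fun u => c u - d u) (special_union c0 d0 cs ds cd)) u.
  move=> u; rewrite !inE negb_or !negbK => /andP[/eqP-> /eqP->]; exact: subrr.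
by move=> i j; rewrite /marginal sumrB -/(marginal c i j) cd subrr.
Qed.

Lemma path_zip (a : R) l p : path <=%R a l -> p \in zip (a :: l) l ->
  a <= p.1 <= p.2.
Proof.
elim: l a => [|b l IH] a //= /andP[ab bl]; rewrite inE => /predU1P[->|/(IH _ bl)].
  by rewrite lexx.
by move=> /andP[bp ->]; rewrite (le_trans ab).
Qed.

(** The gaps before [y] telescope; repeated entries only contribute gaps of length zero. *)
Lemma telescope_zip (y a : R) l : path <=%R a l -> y \in a :: l ->
  \sum_(p <- zip (a :: l) l | p.1 < y) (p.2 - p.1) = y - a.
Proof.
elim: l a => [|b l IH] a; first by rewrite /= inE big_nil => _ /eqP->; rewrite subrr.
move=> /[dup] abl /andP[ab bl]; rewrite inE => /predU1P[->|yl].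
  rewrite subrr big_seq_cond big1// => p /andP[/(path_zip abl)/andP[ap _]].
  by rewrite ltNge ap.
rewrite big_cons/= IH//.
have ay : a <= y by have /allP/(_ y yl) := order_path_min le_trans abl.
have [_|ya] := ltP; first by rewrite addrC subrKA.
have e : a = y by apply/le_anti; rewrite ay.
suff : b = a by move=> ->.
apply/le_anti; rewrite ab andbT e.
move: yl; rewrite inE => /predU1P[->//|yl].
by have /allP/(_ y yl) := order_path_min le_trans bl.
Qed.

(* With [F = x _ 0], [E = x _ 2] and [L = max (F + E)], attained at [k], send
   [t] in [[0, L[] to the vertex that is [0] at [i] for [t < F i], [2] for
   [L - E i <= t], and [1] in between. This is a step function increasing in
   [t], and [c] measures its fibres. *)
Lemma special_cover (i0 : 'I_n) (x : 'I_n -> 'I_3 -> R) :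
    (forall i j, 0 <= x i j) -> (forall i, \sum_j x i j = 1) ->
  exists c, [/\ forall u, 0 <= c u, special (supp c),
    \sum_u c u = 1 & forall i j, marginal c i j = x i j].
Proof.
move=> x0 x1.
have x3 i : x i 0 + x i 1 + x i ord_max = 1.
  rewrite -(x1 i) !big_ord_recl big_ord0 addr0 addrA.
  by congr (_ + x i _ + x i _); exact: val_inj.
pose FE i := x i 0 + x i ord_max.
have [k _ kmax] := @arg_maxP _ _ _ i0 xpredT FE isT.
set L := FE k in kmax; pose H i := L - x i ord_max.
have FH i : x i 0 <= H i by rewrite lerBrDr; apply: kmax.
have FL i : x i 0 <= L by apply: le_trans (kmax i _) => //; rewrite lerDl x0.
have HL i : H i <= L by rewrite gerBl x0.
have FkHk : x k 0 = H k by rewrite /H /L /FE addrK.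
have L1 : L <= 1 by rewrite /L /FE; move: (x3 k) (x0 k 1); lra.
pose v (t : R) : vert n := [ffun i => if t < x i 0 then 0 else if t < H i then 1 else ord_max].
(* The step function can change only at the numbers [x i 0] and [H i]; [L] is listed so that the
   gaps before it add up to [L]. *)
pose bps := L :: [seq x i 0 | i : 'I_n] ++ [seq H i | i : 'I_n].
pose l := sort <=%R bps.
have l0 : path <=%R 0 l.
  rewrite path_min_sorted ?sort_le_sorted//; apply/allP => y.
  rewrite mem_sort inE mem_cat => /predU1P[->|]; first exact: le_trans (FL k).
  case/orP => /mapP[i _ ->] //; exact: le_trans (FH i).
pose ps := zip (0 :: l) l.
have tel y : y \in bps -> \sum_(p <- ps | p.1 < y) (p.2 - p.1) = y.
  by move=> yb; rewrite telescope_zip ?subr0// inE mem_sort yb orbT.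
have telF i : \sum_(p <- ps | p.1 < x i 0) (p.2 - p.1) = x i 0.
  by rewrite tel// inE mem_cat map_f ?orbT// mem_enum.
have telH i : \sum_(p <- ps | p.1 < H i) (p.2 - p.1) = H i.
  by rewrite tel// inE mem_cat [X in _ || (_ || X)]map_f ?orbT// mem_enum.
have telL : \sum_(p <- ps | p.1 < L) (p.2 - p.1) = L by rewrite tel// inE eqxx.
have ps0 p : p \in ps -> 0 <= p.2 - p.1.
  by move/(path_zip l0)/andP=> [_]; rewrite subr_ge0.
(* Each gap counts for the vertex at its left end; the remaining mass [1 - L] goes to the constant
   map 1. *)
pose c u := \sum_(p <- ps | (p.1 < L) && (v p.1 == u)) (p.2 - p.1) +
  (u == corner 1)%:R * (1 - L).
have csupp u : u \in supp c -> u != corner 1 -> exists t : R, u = v t.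
  rewrite inE => + u1; apply: contraPP => h; apply/negP; rewrite negbK.
  rewrite /c (negPf u1) mul0r addr0 big1// => p /andP[_ /eqP e].
  by exfalso; apply: h; exists p.1.
have cE i j : marginal c i j =
    \sum_(p <- ps | (p.1 < L) && (v p.1 i == j)) (p.2 - p.1) + (j == 1)%:R * (1 - L).
  rewrite /marginal big_split; congr (_ + _).
    rewrite [RHS](partition_big (fun p => v p.1) (fun u : vert n => u i == j)) => [|p /andP[]//].
    apply: eq_bigr => u /eqP ui; apply: eq_bigl => p.
    rewrite -andbA; congr andb; case: (eqVneq (v p.1) u) => [->|_]; last by rewrite andbF.
    by rewrite ui eqxx.
  rewrite big_mkcond (bigD1 (corner 1)) //= ffunE eqxx mul1r big1 ?addr0.
    by rewrite eq_sym; case: eqP; rewrite ?mul1r ?mul0r.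
  by move=> u /negPf->; rewrite mul0r if_same.
have c0E i : marginal c i 0 = x i 0.
  rewrite cE mul0r addr0 -[RHS]telF; apply: eq_bigl => p; rewrite ffunE.
  have [pF|] := ltP p.1 (x i 0); first by rewrite (lt_le_trans pF).
  by case: (p.1 < H i); rewrite andbF.
have c2E i : marginal c i ord_max = x i ord_max.
  rewrite cE mul0r addr0; have /eqP := telL; rewrite (bigID (fun p => p.1 < H i)) /=.
  rewrite (eq_bigl (fun p => p.1 < H i)) => [|p]; last first.
    by rewrite andbC; have [pH|//] := ltP p.1 (H i); rewrite (lt_le_trans pH).
  rewrite telH addrC eq_sym -subr_eq /H opprB addrC subrK => /eqP->; apply: eq_bigl => p.
  rewrite ffunE; have [pF|_] := ltP p.1 (x i 0); first by rewrite (lt_le_trans pF (FH i)).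
  by case: ifP.
have ctot : \sum_u c u = 1.
  rewrite big_split /= [X in _ + X](bigD1 (corner 1)) //= eqxx mul1r [X in _ - _ + X]big1.
    rewrite addr0 -(partition_big (fun p => v p.1) xpredT)//= telL; lra.
  by move=> u /negPf->; rewrite mul0r.
exists c; split => //.
- move=> u; rewrite addr_ge0 ?mulr_ge0 ?ler0n ?subr_ge0//.
  by rewrite big_seq_cond sumr_ge0// => p /andP[/ps0].
- split; last first.
    move=> u w us ws u1 w1; have [t ->] := csupp _ us u1; have [t' ->] := csupp _ ws w1.
    wlog tt : t t' / t <= t' => [hw|].
      by case/orP: (le_total t t') => /hw//; rewrite orbC.
    apply/orP; left; apply/forallP => i; rewrite !ffunE.
    have [//|Ft] := ltP t (x i 0); rewrite [t' < x i 0]ltNge (le_trans Ft tt) /=.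
    have [Ht|Ht] := ltP t (H i); first by case: ifP.
    by rewrite [t' < H i]ltNge (le_trans Ht tt).
  (* At [k] the range [[x k 0, H k[] of the value 1 is empty. *)
  exists k => u us u1; have [t ->] := csupp _ us u1.
  by rewrite ffunE FkHk; case: (t < H k).
(* The marginal at 1 follows from the other two, the total being 1 on both sides. *)
- move=> i j; case: (I3P j) => -> //.
  have := x3 i; rewrite -ctot (sum_marginal3 _ i) c0E c2E => /addIr/addrI->//.
Qed.

End Coefficients.
End Vertices.

(** * The triangulation *)

Section Triangulation.
Context {R : realType} {n : nat}.
Implicit Types (u v w : vert n) (s t : {set vert n}) (c d : vert n -> R).

Definition mx v : 'M[R]_(3, n) := \matrix_(j, i) (v i == j)%:R.

(** A left inverse of [mx]; the default 0 only concerns matrices having a column without an entry 1,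
    which are not vertices. *)
Definition unmx (x : 'M[R]_(3, n)) : vert n := [ffun i => odflt 0 [pick j | x j i == 1]].

Lemma mxK : cancel mx unmx.
Proof.
move=> v; apply/ffunP => i; rewrite ffunE; case: pickP => [j|/(_ (v i))].
  by rewrite mxE; have [->//|_] := eqVneq (v i) j; rewrite eq_sym oner_eq0.
by rewrite mxE eqxx eqxx.
Qed.

Definition mxs s : {fset 'M[R]_(3, n)} := [fset mx v | v in s]%fset.

Lemma mxsP s x : reflect (exists2 v, v \in s & x = mx v) (x \in mxs s).
Proof. exact: imfsetP. Qed.

Lemma mem_mxs s v : (mx v \in mxs s) = (v \in s).
Proof. by rewrite /mxs mem_imfset//; exact: (can_inj mxK). Qed.

Lemma big_mxs (V : nmodType) s (F : 'M[R]_(3, n) -> V) :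
  \sum_(x <- mxs s) F x = \sum_(v in s) F (mx v).
Proof.
rewrite /mxs big_imfset/=; last by move=> u v _ _; exact: (can_inj mxK).
by rewrite big_enum.
Qed.

Definition comb c := \sum_u c u *: mx u.

Lemma combE c i j : comb c j i = marginal c i j.
Proof.
rewrite /comb summxE /marginal [RHS]big_mkcond; apply: eq_bigr => u _.
by rewrite !mxE; case: eqP; rewrite ?mulr1 ?mulr0.
Qed.

Lemma eq_comb c d : comb c = comb d <-> forall i j, marginal c i j = marginal d i j.
Proof.
split=> [e i j|e]; first by rewrite -!combE e.
by apply/matrixP => j i; rewrite !combE.
Qed.

Lemma sum_on (V : nmodType) s (F : vert n -> V) : (forall u, u \notin s -> F u = 0) ->
  \sum_(u in s) F u = \sum_u F u.
Proof.
move=> F0; rewrite [RHS](bigID [in s]) /= [X in _ + X]big1 ?addr0//.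
Qed.

(** Combinations over a simplex become weights on all of [vert n] vanishing off [s], so that
    different simplices can be compared; [mxs_affine] goes back. *)
Lemma affine_mxs s (C : 'M[R]_(3, n) -> R) : exists c,
  [/\ forall u, u \notin s -> c u = 0, forall u, u \in s -> c u = C (mx u),
      \sum_(x <- mxs s) C x = \sum_u c u & \sum_(x <- mxs s) C x *: x = comb c].
Proof.
exists (fun u => if u \in s then C (mx u) else 0); split.
- by move=> u /negPf->.
- by move=> u ->.
- by rewrite big_mxs big_mkcond.
- rewrite big_mxs big_mkcond; apply: eq_bigr => u _; case: ifP => //.
  by rewrite scale0r.
Qed.

Lemma mxs_affine s c : (forall u, u \notin s -> c u = 0) ->
  \sum_(x <- mxs s) c (unmx x) = \sum_u c u /\
  \sum_(x <- mxs s) c (unmx x) *: x = comb c.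
Proof.
move=> c0; rewrite !big_mxs; under eq_bigr do rewrite mxK.
under [X in _ /\ X = _]eq_bigr do rewrite mxK.
by split; apply: sum_on => // u /c0->; rewrite scale0r.
Qed.

Lemma conv_mxs s x : conv_hull (mxs s) x <-> exists c,
  [/\ forall u, 0 <= c u, forall u, u \notin s -> c u = 0, \sum_u c u = 1 & x = comb c].
Proof.
split=> [[C [C0 C1 ->]]|[c [c0 cs c1 ->]]].
  have [c [c0 cC e1 e2]] := affine_mxs s C.
  exists c; split; rewrite -?e1 -?e2// => u.
  by have [us|/c0->//] := boolP (u \in s); rewrite cC// C0// mem_mxs.
have [e1 e2] := mxs_affine cs.
by exists (c \o unmx); split; rewrite ?e1 ?e2//= => y _.
Qed.

Definition simplices : {fset {fset 'M[R]_(3, n)}} :=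
  [fset mxs s | s in [set s : {set vert n} | `[< special s >]]]%fset.

Lemma simplicesP (S : {fset 'M[R]_(3, n)}) :
  reflect (exists2 s, special s & S = mxs s) (S \in simplices).
Proof.
apply: (iffP (imfsetP _ _ _ _)) => [[s]|[s sp ->]].
  by rewrite !inE => /asboolP; exists s.
by exists s => //; rewrite inE; apply/asboolP.
Qed.

Lemma supp_sub s c : (forall u, u \notin s -> c u = 0) -> supp c \subset s.
Proof.
by move=> c0; apply/fintype.subsetP => u; rewrite inE; apply: contraNT => /c0->.
Qed.

Lemma triangleP (y : 'cV[R]_3) :
  triangle R y <-> (forall j, 0 <= y j 0) /\ \sum_j y j 0 = 1.
Proof.
have inj : injective (fun i : 'I_3 => delta_mx i 0 : 'cV[R]_3).
  move=> i j /matrixP/(_ i 0); rewrite !mxE !eqxx !andbT.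
  by case: eqP => // _ /eqP; rewrite oner_eq0.
pose D := [fset (delta_mx i 0 : 'cV[R]_3) | i in 'I_3]%fset.
have bigD (V : nmodType) (F : 'cV[R]_3 -> V) : \sum_(x <- D) F x = \sum_i F (delta_mx i 0).
  by rewrite /D big_imfset/= ?big_enum//; move=> i j _ _; exact: inj.
have yE (z : 'cV[R]_3) : z = \sum_i z i 0 *: delta_mx i 0.
  by rewrite [LHS]matrix_sum_delta; apply: eq_bigr => i _; rewrite big_ord1.
have sumE (F : 'I_3 -> R) j : (\sum_i F i *: (delta_mx i 0 : 'cV[R]_3)) j 0 = F j.
  rewrite summxE (bigD1 j) //= !mxE !eqxx mulr1 big1 ?addr0// => i ij.
  by rewrite !mxE eq_sym (negPf ij) mulr0.
rewrite /triangle -/D; split=> [[C [C0 C1 ->]]|[y0 y1]].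
  rewrite !bigD in C1 *; split=> [j|]; rewrite ?sumE.
    by apply: C0; apply/imfsetP; exists j.
  by rewrite -[RHS]C1; apply: eq_bigr => j _; rewrite sumE.
(* Coefficients are functions on all column vectors; this one takes the value [y j 0] at the [j]-th
   unit vector. *)
exists (fun x => \sum_j (x == delta_mx j 0)%:R * y j 0); rewrite !bigD.
have cE i : \sum_j (delta_mx i 0 == delta_mx j 0 :> 'cV[R]_3)%:R * y j 0 = y i 0.
  rewrite (bigD1 i)//= eqxx mul1r big1 ?addr0// => j ji.
  by rewrite (inj_eq inj) eq_sym (negPf ji) mul0r.
split.
- by move=> v _; apply: sumr_ge0 => j _; rewrite mulr_ge0 ?ler0n.
- by rewrite -[RHS]y1; apply: eq_bigr => i _; exact: cE.
- by rewrite [LHS]yE; apply: eq_bigr => i _; rewrite cE.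
Qed.

Lemma triangle_powerP (x : 'M[R]_(3, n)) : triangle_power R n x <->
  (forall i j, 0 <= x j i) /\ forall i, \sum_j x j i = 1.
Proof.
split=> [xP|[x0 x1] i].
  split=> i; have /triangleP[y0 y1] := xP i; first by move=> j; have := y0 j; rewrite mxE.
  by rewrite -[RHS]y1; apply: eq_bigr => j _; rewrite mxE.
apply/triangleP; split=> [j|]; first by rewrite mxE.
by rewrite -[RHS](x1 i); apply: eq_bigr => j _; rewrite mxE.
Qed.

Lemma comb_triangle_power c : (forall u, 0 <= c u) -> \sum_u c u = 1 ->
  triangle_power R n (comb c).
Proof.
move=> c0 c1; apply/triangle_powerP; split=> i.
  by move=> j; rewrite combE sumr_ge0.
by under eq_bigr do rewrite combE; rewrite -sum_marginal.
Qed.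

Lemma sub_mxs s (t : {fset 'M[R]_(3, n)}) : (t `<=` mxs s)%fset ->
  exists2 s' : {set vert n}, s' \subset s & t = mxs s'.
Proof.
move=> /fsubsetP ts; exists [set u in s | mx u \in t].
  by apply/fintype.subsetP => u; rewrite inE => /andP[].
apply/fsetP => x; apply/idP/mxsP => [xt|[v]].
  by have /mxsP[v vs e] := ts _ xt; exists v => //; rewrite inE vs -e.
by rewrite inE => /andP[_ vt] ->.
Qed.

(** The four properties come from [special_coef0], [special_sub], [marginal_inj] and
    [special_cover], in this order. *)
Lemma simplices_triangulation : (0 < n)%N -> triangulation (triangle_power R n) simplices.
Proof.
move=> n0; split.
- move=> _ /simplicesP[s sp ->] C.
  have [c [c0 cC -> ->]] := affine_mxs s C => _ /matrixP ce _ /mxsP[u us ->].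
  rewrite -cC//; apply: (special_coef0 sp) => // i j.
  by rewrite -combE ce mxE.
- move=> _ t /simplicesP[s sp ->] /sub_mxs[s' s's ->]; apply/simplicesP.
  by exists s' => //; exact: special_sub sp.
- move=> _ _ /simplicesP[s sp ->] /simplicesP[t tp ->].
  exists (mxs (s :&: t)); split.
  + by apply/fsubsetP => _ /mxsP[v /setIP[vs vt] ->]; rewrite mem_mxs.
  + by apply/fsubsetP => _ /mxsP[v /setIP[vs vt] ->]; rewrite mem_mxs.
  + apply/seteqP; split=> [x [/conv_mxs[c [c0 cs c1 ->]]]|x].
      move/conv_mxs=> [d [d0 dt d1 /eq_comb cd]]; apply/conv_mxs; exists c; split=> // u.
      have e := marginal_inj c0 d0 (special_sub (supp_sub cs) sp)
        (special_sub (supp_sub dt) tp) cd u.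
      by rewrite inE negb_and => /orP[/cs//|/dt]; rewrite e.
    move/conv_mxs=> [c [c0 cs c1 ->]]; split; apply/conv_mxs; exists c; split=> // u us;
    by apply: cs; rewrite inE (negPf us) ?andbF.
- apply/seteqP; split=> [_ [_ /simplicesP[s sp ->] /conv_mxs[c [c0 cs c1 ->]]]|x].
    exact: comb_triangle_power.
  move/triangle_powerP => [x0 x1].
  have [c [c0 cs c1 ce]] := special_cover (Ordinal n0) x0 x1.
  exists (mxs (supp c)); first by apply/simplicesP; exists (supp c).
  apply/conv_mxs; exists c; split=> //; first by move=> u; rewrite inE negbK => /eqP.
  by apply/matrixP => j i; rewrite combE ce.
Qed.

Lemma aff_hull_mxs s x : aff_hull [set` mxs s]%classic x ->
  exists c, [/\ forall u, u \notin s -> c u = 0, \sum_u c u = 1 & x = comb c].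
Proof.
move=> [t [C [ts C1 ->]]]; have /sub_mxs[s' /fintype.subsetP s's e] : (t `<=` mxs s)%fset.
  by apply/fsubsetP => y /ts.
have [c [c0 _ e1 e2]] := affine_mxs s' C.
exists c; split; rewrite -?e1 -?e2 -?e// => u us.
by apply: c0; apply: contra us => /s's.
Qed.

Lemma mx_int v : mx v \is a mxOver Num.int.
Proof. by apply/mxOverP => j i; rewrite mxE rpred_nat. Qed.

Lemma aff_hull_mx v : aff_hull (triangle_power R n) (mx v).
Proof.
exists [fset mx v]%fset, (fun=> 1); rewrite !big_seq_fset1 scale1r; split=> // x /=.
rewrite inE => /eqP->; apply/triangle_powerP; split=> [i j|i]; first by rewrite mxE ler0n.
rewrite (bigD1 (v i)) //= mxE eqxx big1 ?addr0// => j ji.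
by rewrite mxE eq_sym (negPf ji).
Qed.

(** * Integral combinations of the edges at a vertex *)

Section Basis.
Context (s : {set vert n}) (v0 : vert n).

Definition edges := [fset x - mx v0 | x in (mxs s `\ mx v0)%fset]%fset.

Lemma edgesP x : reflect (exists2 u, u \in s :\ v0 & x = mx u - mx v0) (x \in edges).
Proof.
apply: (iffP (imfsetP _ _ _ _)) => [[y /fsetD1P[yv /mxsP[u us yE]] ->]|[u]].
  exists u; rewrite -?yE// !inE us andbT; apply: contra_neq yv => uv.
  by rewrite yE uv.
rewrite !inE => /andP[uv us] ->; exists (mx u) => //; rewrite !inE mem_mxs us andbT.
by apply: contra_neq uv => /(can_inj mxK).
Qed.

(** The combination of the edges with coefficients [g], rewritten as weights of total zero on the
    vertices: each edge takes its coefficient away from [v0]. *)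
Definition edge_coef (g : 'M[R]_(3, n) -> int) u : R :=
  if u \in s :\ v0 then (g (mx u - mx v0))%:~R else
  if u == v0 then - \sum_(w in s :\ v0) (g (mx w - mx v0))%:~R else 0.

Lemma sum_edges (g : 'M[R]_(3, n) -> int) :
  \sum_(b : edges) val b *~ g (val b) = comb (edge_coef g).
Proof.
rewrite -(big_seq_fsetE _ edges xpredT (fun b => b *~ g b)).
rewrite /edges big_imfset/=; last by move=> x y _ _ /addIr.
rewrite (_ : (mxs s `\ mx v0)%fset = mxs (s :\ v0)); last first.
  apply/fsetP => x; apply/fsetD1P/mxsP => [[xv /mxsP[u us xu]]|[u /setD1P[uv us] ->]].
    exists u => //; rewrite !inE us andbT; apply: contra_neq xv => uv.
    by rewrite xu uv.
  rewrite mem_mxs; split=> //; apply: contra_neq uv; exact: (can_inj mxK).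
rewrite big_mxs /comb [RHS](bigD1 v0) //= {1}/edge_coef !inE eqxx /=.
have -> : \sum_(u | u != v0) edge_coef g u *: mx u =
    \sum_(u in s :\ v0) (g (mx u - mx v0))%:~R *: mx u.
  rewrite (bigID [in s]) /= [X in _ + X]big1 ?addr0.
    apply: eq_big => [u|u /andP[uv us]]; first by rewrite !inE.
    by rewrite /edge_coef !inE uv us.
  by move=> u /andP[/negPf uv /negPf us]; rewrite /edge_coef !inE us andbF uv scale0r.
rewrite scaleNr scaler_suml -sumrN -big_split; apply: eq_bigr => u us /=.
by rewrite addrC -scalerBr scaler_int.
Qed.

End Basis.

(** By full dimension, a lattice vector is a difference of two affine combinations over [s], hence
    has weights of total zero; these are integral by [special_coef]. Away from [v0] they are the
    coordinates in the edges, unique by [special_coef0]. *)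
Lemma simplices_unimodular : unimodular (triangle_power R n) simplices.
Proof.
split=> [_ _ /simplicesP[s _ ->] /mxsP[v _ ->]|_ /simplicesP[s sp ->] full]; first exact: mx_int.
move=> _ /mxsP[v0 v0s ->]; rewrite -/(edges s v0); split.
  move=> _ /edgesP[u _ ->]; split; first by apply/mxOverP => i j; rewrite !mxE rpredB ?rpred_nat.
  by exists (mx u), (mx v0); split=> //; exact: aff_hull_mx.
move=> w [wint [x [y []]]]; rewrite -full => /aff_hull_mxs[c [cs c1 ->]].
move=> /aff_hull_mxs[d [ds d1 ->]] wE.
pose e u := c u - d u.
have es u : u \notin s -> e u = 0 by move=> us; rewrite /e cs ?ds ?subrr.
have we : w = comb e.
  by rewrite wE /comb -sumrB; apply: eq_bigr => u _; rewrite scalerBl.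
have e0 : \sum_u e u = 0 by rewrite sumrB c1 d1 subrr.
have eint u : e u \is a Num.int.
  apply: (special_coef sp) => // i j; rewrite -combE -we; exact/mxOverP.
have coefE g : (forall u, u \in s :\ v0 -> (g (mx u - mx v0))%:~R = e u) ->
    forall u, edge_coef s v0 g u = e u.
  move=> ge u; rewrite /edge_coef; case: ifPn => [/ge//|].
  rewrite !inE negb_and negbK; case: eqP => [-> _|_ /= us]; last by rewrite es.
  rewrite (eq_bigr _ ge); apply/eqP; rewrite eqr_oppLR -addr_eq0; apply/eqP.
  rewrite -[RHS]e0 -[RHS](sum_on es) [RHS](bigD1 v0)//= addrC; congr (_ + _).
  by apply: eq_bigl => v; rewrite !inE andbC.
(* Adding [mx v0] turns an edge back into its other end; as [e] is integral, the floor loses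
   nothing. *)
pose g x := Num.floor (e (unmx (x + mx v0))).
have gE u : (g (mx u - mx v0))%:~R = e u by rewrite /g subrK mxK floorK.
exists [ffun b : edges s v0 => g (val b)]; split.
  under eq_bigr do rewrite ffunE; rewrite sum_edges we.
  by apply: eq_bigr => u _; rewrite coefE.
move=> h wh; apply/ffunP => b; rewrite ffunE.
(* [h] is defined on the edges only; it is extended by 0 so that [edge_coef] applies. *)
pose h' x := if insub x is Some b then h b else 0.
have h'E (b' : edges s v0) : h b' = h' (val b') by rewrite /h' valK.
have /edgesP[u us bE] := valP b.
have {}wh : comb e = comb (edge_coef s v0 h').
  by rewrite -we wh -sum_edges; apply: eq_bigr => b' _; rewrite h'E.
have eh v : e v - edge_coef s v0 h' v = 0.
  apply: (special_coef0 sp (c := fun v => e v - edge_coef s v0 h' v)) => [v' vs|i j].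
    rewrite es// /edge_coef !inE (negPf vs) andbF ifF ?subrr//.
    by apply: contraNF vs => /eqP->.
  by rewrite /marginal sumrB -!/(marginal _ i j) -!combE wh subrr.
apply: (@intr_inj R); rewrite h'E bE gE; apply/eqP; rewrite -subr_eq0.
by rewrite -[X in _ - X](_ : edge_coef s v0 h' u = _) ?eh// /edge_coef us.
Qed.

End Triangulation.

(** * Cones and the rays of the fan *)

Section Cones.
Context (R : realType) (W : lmodType R).
Implicit Types (G H : {fset W}) (g h w : W).

(** A dual system makes the cone over [G] simplicial; it is stated through functionals because these
    cut out the faces in [cone_face]. *)
Definition has_dual G := forall g, g \in G ->
  exists l : {scalar W}, forall h, h \in G -> l h = (g == h)%:R.

Lemma has_dual_sub G H : (H `<=` G)%fset -> has_dual G -> has_dual H.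
Proof.
by move=> /fsubsetP HG dG g /HG/dG[l lE]; exists l => h /HG; exact: lE.
Qed.

Lemma mem_cone G g : g \in G -> cone G g.
Proof.
move=> gG; exists (fun h => (h == g)%:R) => [h _|]; first exact: ler0n.
rewrite (big_fsetD1 g)//= eqxx scale1r big1_fset ?addr0// => h.
by rewrite !inE => /andP[/negPf->]; rewrite scale0r.
Qed.

Lemma cone1P w x : cone [fset w]%fset x <-> exists2 a : R, 0 <= a & x = a *: w.
Proof.
split=> [[c c0 ->]|[a a0 ->]].
  by exists (c w); rewrite ?c0 ?inE// big_seq_fset1.
by exists (fun=> a); rewrite ?big_seq_fset1.
Qed.

(** Add up the functionals dual to the entries of [s]; only the vanishing of the sum matters, so
    entries may repeat. *)
Lemma scalar_separator G (s : seq W) : has_dual G -> {subset s <= G} ->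
  exists l : {scalar W}, forall h, h \in G -> 0 <= l h /\ (l h == 0) = (h \notin s).
Proof.
move=> dG; elim: s => [|g s IH] sG; first by exists \0 => h _; rewrite lexx eqxx.
have [|l lP] := IH; first by move=> x xs; apply: sG; rewrite inE xs orbT.
have [l' l'P] := dG g (sG _ (mem_head _ _)).
exists (l \+ l') => h hG /=; have [l0 lE] := lP _ hG.
rewrite l'P//; split; first by rewrite addr_ge0 ?ler0n.
by rewrite paddr_eq0 ?ler0n// lE inE negb_or andbC pnatr_eq0 eqb0 [g == h]eq_sym.
Qed.

(** A vanishing sum of nonnegative terms [c g * l g] has only zero terms, so [c g] is zero unless
    [l g] is. *)
Lemma cone_null G (l : {scalar W}) : (forall g, g \in G -> 0 <= l g) ->
  (cone G `&` [set x | l x = 0])%classic = cone [fset g in G | l g == 0]%fset.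
Proof.
move=> l0; set H := [fset _ | _ in _ & _]%fset.
have HG : (H `<=` G)%fset by exact: fset_sub.
have lsum A (c : W -> R) : l (\sum_(g <- A) c g *: g) = \sum_(g <- A) c g * l g.
  by rewrite linear_sum; apply: eq_bigr => g _; rewrite linearZ.
apply/seteqP; split=> [x [[c c0 xE] /= lx]|x [c c0 xE]].
  exists c => [g|]; first by rewrite !inE => /andP[/c0].
  rewrite xE; symmetry; apply: big_fset_incl => // g gG gH.
  suff -> : c g = 0 by rewrite scale0r.
  move/eqP: lx; rewrite xE lsum big_seq psumr_eq0 => [/allP/(_ g gG)|h hG].
    by rewrite gG mulf_eq0 => /orP[/eqP//|lg]; move: gH; rewrite !inE gG lg.
  by rewrite mulr_ge0 ?c0 ?l0.
split=> /=.
  exists (fun g => if g \in H then c g else 0) => [g _|]; first by case: ifP => // /c0.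
  rewrite xE -(big_fset_incl _ HG) => [|g _ /negPf->]; last by rewrite scale0r.
  by apply: eq_big_seq => g ->.
rewrite xE lsum big_seq big1// => g; rewrite !inE => /andP[_ /eqP->].
by rewrite mulr0.
Qed.

(** A functional cuts out the generators at which it vanishes; conversely the separator of the
    complement of [H] vanishes exactly on [H]. *)
Lemma dual_faceP G (F : set W) : has_dual G ->
  cone_face F (cone G) <-> exists2 H, (H `<=` G)%fset & F = cone H.
Proof.
move=> dG; split=> [[l [l0 ->]]|[H HG ->]].
  exists [fset g in G | l g == 0]%fset; first exact: fset_sub.
  by apply: cone_null => g /mem_cone; exact: l0.
have [|l lP] := @scalar_separator G (G `\` H)%fset dG.
  by move=> g; rewrite inE => /andP[].
have l0 g : g \in G -> 0 <= l g by move=> /lP[].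
exists l; split.
  move=> x [c c0 ->]; rewrite linear_sum big_seq sumr_ge0// => g gG.
  by rewrite linearZ mulr_ge0 ?c0 ?l0.
rewrite cone_null//; congr cone; apply/fsetP => g; rewrite !inE.
have [gG|gG] := boolP (g \in G); last first.
  by apply: contraNF gG; exact: (fsubsetP HG).
by have [_ ->] := lP _ gG; rewrite inE gG andbT negbK.
Qed.

Lemma dual_neq0 G g : has_dual G -> g \in G -> g != 0.
Proof.
move=> dG gG; have [l lP] := dG _ gG; apply/eqP => g0.
by have /eqP := lP _ gG; rewrite eqxx g0 linear0 eq_sym oner_eq0.
Qed.

Lemma dual_rayP G (r : set W) : has_dual G ->
  is_ray r /\ cone_face r (cone G) <-> exists2 g, g \in G & r = cone [fset g]%fset.
Proof.
move=> dG; split=> [[[w w0 ->] /(dual_faceP _ dG)[H HG wH]]|[g gG ->]]; last first.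
  split; first by exists g => //; exact: dual_neq0 gG.
  by apply/dual_faceP => //; exists [fset g]%fset => //; rewrite fsub1set.
have dH := has_dual_sub HG dG.
have [H0|[g gH]] := fset_0Vmem H.
  move: w0; have [c _ ->] : cone H w by rewrite -wH; apply: mem_cone; rewrite inE.
  by rewrite H0 big_seq_fset0 eqxx.
exists g; first exact: (fsubsetP HG).
rewrite wH; congr cone; apply/fsetP => h; rewrite inE; apply/idP/eqP => [hH|->//].
have [a _ ha] : exists2 a : R, 0 <= a & h = a *: w.
  by apply/cone1P; rewrite wH; exact: mem_cone.
have [b _ gb] : exists2 a : R, 0 <= a & g = a *: w.
  by apply/cone1P; rewrite wH; exact: mem_cone.
(* If [h] differed from [g], the functional dual to [g] would be 1 on [g] and 0 on [h]; both being
   multiples of [w], this forces [h = 0]. *)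
apply/eqP; rewrite eq_sym; apply: contraTT (dual_neq0 dH hH) => /negPf gh; rewrite negbK.
have [l lP] := dH _ gH; have := lP _ hH; have := lP _ gH.
rewrite gh eqxx {1}gb ha !linearZ /= => bl /eqP; rewrite mulf_eq0 => /orP[/eqP->|/eqP lw].
  by rewrite scale0r.
by move/eqP: bl; rewrite lw mulr0 eq_sym oner_eq0.
Qed.

Lemma rays_of_dual G : has_dual G ->
  rays_of (cone G) = [set cone [fset g]%fset | g in [set` G]]%classic.
Proof.
move=> dG; apply/seteqP; split=> r; first by move/(dual_rayP _ dG)=> [g gG ->]; exists g.
by move=> [g gG <-]; apply/(dual_rayP _ dG); exists g.
Qed.

End Cones.

(** * The rays attached to the vertices *)

Section Fan.
Local Open Scope quotient_scope.
Context {R : realType} {n : nat}.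
Implicit Types (i k : 'I_n) (S T : {set 'I_n}) (u v w : vert n) (s : {set vert n}).
Implicit Types (b : (n.*2.-1).-tuple 'I_n).

Local Notation Q := (quotv <[const_mx 1 : 'rV[R]_n]>%VS).
Local Notation W := (Nspace R n * Nspace R n)%type.

Lemma pi_eqP (x y : 'rV[R]_n) :
  (\pi_Q x = \pi_Q y) <-> exists a, forall i, x 0 i = y 0 i + a.
Proof.
split=> [/eqP|[a xy]].
  rewrite pi_quotv_eq => /vlineP[a e]; exists a => i.
  by move/rowP/(_ i): e; rewrite !mxE mulr1 => <-; rewrite addrCA subrr addr0.
apply/eqP; rewrite pi_quotv_eq; apply/vlineP; exists a; apply/rowP => i.
by rewrite !mxE xy mulr1 addrC addKr.
Qed.

(** A coordinate difference kills the all-ones vector, so any representative may be used; the values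
    lie in [R^o] to make it a linear form. *)
Definition diff i k (x : Nspace R n) : R^o :=
  (repr (x : Q) 0 i - repr (x : Q) 0 k : R).

Lemma diff_pi i k (x : 'rV[R]_n) : diff i k (\pi_Q x) = x 0 i - x 0 k :> R.
Proof.
rewrite /diff; have /pi_eqP[a e] : (\pi_Q (repr (\pi_Q x)) = \pi_Q x) by rewrite reprK.
by rewrite !e; ring.
Qed.

Lemma diff_linear i k : linear (diff i k).
Proof.
move=> a; elim/quotW => x; elim/quotW => y.
have -> : a *: (\pi_Q x : Nspace R n) + \pi_Q y = (\pi_Q (a *: x + y)).
  by rewrite -pi_quotvD -pi_quotvZ.
rewrite !diff_pi !mxE /GRing.scale/=; ring.
Qed.

HB.instance Definition _ i k :=
  GRing.isLinear.Build R (Nspace R n) R^o *:%R (diff i k) (diff_linear i k).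

Lemma diff_indic i k S : diff i k (indic R S) = (i \in S)%:R - (k \in S)%:R :> R.
Proof. by rewrite diff_pi !mxE. Qed.

Definition gen v : W := evec R [set i | v i != 0] + fvec R [set i | v i != ord_max].

Lemma genE v : gen v = (indic R [set i | v i != 0], indic R [set i | v i != ord_max]).
Proof. by rewrite /gen /evec /fvec; congr pair => /=; rewrite ?addr0 ?add0r. Qed.

Definition ray v : set W := cone [fset gen v]%fset.

(** A check of all values of the four coordinates. The sign of [a] excludes the point reflection
    that exchanges two of the three points. *)
Lemma homothety_rigid (x y x' y' : 'I_3) (a c d : R) : x != y -> 0 <= a ->
  (x != 0)%:R = a * (x' != 0)%:R + c -> (y != 0)%:R = a * (y' != 0)%:R + c ->
  (x != ord_max)%:R = a * (x' != ord_max)%:R + d ->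
  (y != ord_max)%:R = a * (y' != ord_max)%:R + d -> [/\ a = 1, c = 0 & d = 0].
Proof.
move=> + a0; case: (I3P x) => ->; case: (I3P y) => -> // _;
case: (I3P x') => ->; case: (I3P y') => -> /=; rewrite !(mulr0, mulr1, add0r) => *.
all: split; lra.
Qed.

(* [gen] sends the coordinates 0, 1, 2 of a vertex to the points (0,1), (1,1),
   (1,0), up to a common translation; a homothety is determined by the images
   of two distinct points. *)
Lemma ray_inj v w : (forall j, v != corner j) -> ray v = ray w -> v = w.
Proof.
move=> vn vw.
have : ray w (gen v) by rewrite -vw; exact: (mem_cone (fset11 (gen v))).
move=> /cone1P[a a0]; rewrite !genE => -[] /=; rewrite /indic.
(* Equality in the quotient leaves a translation free, one in each factor. *)
have pz (x y : 'rV[R]_n) : (\pi_Q x = a *: (\pi_Q y : Nspace R n)) ->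
    exists c, forall i, x 0 i = a * y 0 i + c.
  rewrite [a *: _]pi_quotvZ => /pi_eqP[c e]; exists c => i; by rewrite e mxE.
move=> /pz[c ce] /pz[d de].
have {}ce i : (v i != 0)%:R = a * (w i != 0)%:R + c by have := ce i; rewrite !mxE !inE.
have {}de i : (v i != ord_max)%:R = a * (w i != ord_max)%:R + d.
  by have := de i; rewrite !mxE !inE.
have [i [j vij]] : exists i j, v i != v j.
  have /existsP[i0 _] : [exists i : 'I_n, v i != 0].
    apply: contraNT (vn 0) => /existsPn v0; apply/eqP/ffunP => i.
    by rewrite ffunE; apply/eqP; rewrite -[_ == _]negbK v0.
  have [/existsP[j vj]|/existsPn vj] := boolP [exists j, v i0 != v j]; first by exists i0, j.
  have /negP[] := vn (v i0); apply/eqP/ffunP => j; rewrite ffunE.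
  by have /negPn/eqP := vj j.
have [a1 c0 d0] := homothety_rigid vij a0 (ce i) (ce j) (de i) (de j).
apply/ffunP => l; have := de l; have := ce l; rewrite a1 c0 d0 !mul1r !addr0.
move=> /eqP + /eqP; rewrite !eqr_nat.
by case: (I3P (w l)) => ->; case: (I3P (v l)) => ->.
Qed.

End Fan.

(** * Bipermutations and maximal chains *)

(** The entries satisfying [p] are closed downwards, so they form a prefix, whose length is their
    number. *)
Lemma sorted_take_filter (T : Type) (r : rel T) (p : pred T) (s : seq T) :
    transitive r -> sorted r s -> (forall x y, r x y -> p y -> p x) ->
  take (count p s) s = filter p s /\ drop (count p s) s = filter (predC p) s.
Proof.
move=> rT + rp; elim: s => //= x s IH xs; have [e1 e2] := IH (path_sorted xs).
have [px|px] /= := boolP (p x); first by rewrite e1 e2.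
have sp : all (predC p) s.
  apply: sub_all (order_path_min rT xs) => y xy /=.
  by apply: contra px; exact: rp xy.
have -> : count p s = 0%N.
  by apply/eqP; rewrite -leqn0 leqNgt -has_count -all_predC.
move: sp; rewrite all_predC => hp.
have -> : [seq y <- s | p y] = [::].
  by apply: size0nil; apply/eqP; rewrite size_filter -leqn0 leqNgt -has_count.
by rewrite add0n take0 drop0; split=> //; congr (_ :: _); rewrite (all_filterP _)// all_predC.
Qed.

Lemma count_enum (T : finType) (A : {pred T}) (a : pred T) :
  count a (enum A) = #|[set x in A | a x]|.
Proof.
rewrite cardE -size_filter; apply: perm_size; apply: uniq_perm.
- by rewrite filter_uniq ?enum_uniq.
- exact: enum_uniq.
- by move=> x; rewrite mem_filter !mem_enum inE andbC.
Qed.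

Section Bipermutations.
Context {n : nat}.
Implicit Types (i k : 'I_n) (u v w : vert n) (s : {set vert n}).
Implicit Types (b : (n.*2.-1).-tuple 'I_n) (m : nat).

(* The vertex attached to the ray [e_(b_1..b_m) + f_(b_(m+1)..)]. *)
Definition stage b m : vert n :=
  [ffun i => if i \notin take m b then 0 else if i \in drop m b then 1 else ord_max].

(** The range includes both ends, where the stage of a bipermutation is the constant map 0 or 2. *)
Definition stages b := [set v in [seq stage b m | m <- iota 0 n.*2]].

Lemma stage_take b m i : (stage b m i != 0) = (i \in take m b).
Proof. by rewrite ffunE; case: (i \in take m b) => //=; case: ifP. Qed.

Lemma lev_stage b m m' : (m <= m')%N -> lev (stage b m) (stage b m').
Proof.
move=> mm; apply/forallP => i; rewrite !ffunE.
have tt : i \in take m b -> i \in take m' b.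
  by rewrite -(take_takel b mm); exact: mem_take.
have dd : i \in drop m' b -> i \in drop m b.
  by rewrite -(subnK mm) -drop_drop; exact: mem_drop.
case: (boolP (i \in take m b)) tt => //= _ -> //=.
by case: (boolP (i \in drop m' b)) dd => [_ -> //|_ _]; case: ifP.
Qed.

(** The single occurrence of [k] lies on one side of the cut, so no stage takes the value 1 at
    [k]. *)
Lemma stage_count1 b m k : count_mem k b = 1%N -> (k \in take m b) = (k \notin drop m b).
Proof.
rewrite -{1}(cat_take_drop m b) count_cat -!has_pred1 !has_count.
by case: (count_mem k (take m b)) => [|[|]] //=; case: (count_mem k (drop m b)).
Qed.

Section FixedBipermutation.
Context (b : (n.*2.-1).-tuple 'I_n) (bb : bipermutation b).

Lemma mem_bipermutation i : i \in b.
Proof.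
case: bb => k [bk bi]; rewrite -has_pred1 has_count.
by have [->|/bi->//] := eqVneq i k; rewrite bk.
Qed.

Lemma count_bipermutation i : (count_mem i b <= 2)%N.
Proof. by case: bb => k [bk bi]; have [->|/bi->//] := eqVneq i k; rewrite bk. Qed.

Lemma stage_drop m i : (stage b m i != ord_max) = (i \in drop m b).
Proof.
rewrite ffunE; have : i \in tval b := mem_bipermutation i; rewrite -{1}(cat_take_drop m b) mem_cat.
by case: (i \in take m b) => /= [_|->//]; case: ifP.
Qed.

Lemma stage0 : stage b 0 = corner 0.
Proof. by apply/ffunP => i; rewrite !ffunE take0. Qed.

Lemma stage_last : stage b n.*2.-1 = corner ord_max.
Proof.
apply/ffunP => i; rewrite !ffunE take_oversize ?drop_oversize ?size_tuple//.
by rewrite [_ \in _]mem_bipermutation.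
Qed.

Lemma bipermutation_gt0 : (0 < n)%N.
Proof. by have [i _] := bb; exact: leq_ltn_trans (ltn_ord i). Qed.

Lemma special_stages : special (corner 1 |: stages b).
Proof.
case: bb => k [bk _]; split.
  exists k => u /setU1P[->|]; first by rewrite eqxx.
  rewrite inE => /mapP[m _ ->] _; rewrite ffunE stage_count1// negbK.
  by case: (k \in _).
move=> u v /setU1P[->|]; first by rewrite eqxx.
rewrite inE => /mapP[m _ ->] /setU1P[->|]; first by rewrite eqxx.
rewrite inE => /mapP[m' _ ->] _ _.
by case/orP: (leq_total m m') => /lev_stage->; rewrite ?orbT.
Qed.

Lemma inner_stage v : v \in stages b -> (forall j, v != corner j) ->
  exists2 m, (0 < m < n.*2.-1)%N & v = stage b m.
Proof.
rewrite inE => /mapP[m]; rewrite mem_iota => /andP[_ mn] -> vn; exists m => //.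
rewrite lt0n; apply/andP; split.
  by apply: contra_neqN (vn 0) => /eqP->; rewrite stage0.
rewrite ltn_neqAle; apply/andP; split; last by move: mn; lia.
by apply: contra_neqN (vn ord_max) => /eqP->; rewrite stage_last.
Qed.

(** A nonempty prefix excludes the constant 0, a nonempty suffix the constant 2, and the
    once-occurring element the constant 1. *)
Lemma inner_stageP m : (0 < m < n.*2.-1)%N ->
  stage b m \in stages b /\ forall j, stage b m != corner j.
Proof.
move=> /andP[m0 mn]; split; first by rewrite inE map_f// mem_iota; lia.
pose i0 : 'I_n := Ordinal bipermutation_gt0.
have tk : nth i0 (take m b) 0 \in take m b by rewrite mem_nth// size_takel ?size_tuple; lia.
have dk : nth i0 (drop m b) 0 \in drop m b by rewrite mem_nth// size_drop size_tuple; lia.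
move=> j; case: (I3P j) => ->; apply/eqP => /ffunP e.
- by move: tk; rewrite -stage_take e ffunE eqxx.
- by case: bb => k [bk _]; have := e k; rewrite !ffunE stage_count1// negbK; case: (k \in _).
- by move: dk; rewrite -stage_drop e ffunE eqxx.
Qed.

End FixedBipermutation.

(* Reading off the jumps of a chain: the pair [(i, c)] stands for the passage of
   the [i]-th coordinate from at most [c] to more than [c]; the omitted pair
   [(k, true)] occurs together with [(k, false)]. *)
Lemma special_bipermutation s : (0 < n)%N -> special s ->
  exists2 b, bipermutation b & s \subset corner 1 |: stages b.
Proof.
move=> n0 [[k kP] ch]; pose s' := s :\ corner 1.
pose ev := enum (predC1 (k, true)).
(* The number of chain members before the jump [e]; sorting by it lists the jumps in order of
   occurrence, simultaneous ones arbitrarily. *)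
pose rk (e : 'I_n * bool) := #|[set u in s' | (u e.1 <= e.2)%N]|.
pose E := sort (fun e e' => rk e <= rk e')%N ev.
have szE : size [seq e.1 | e <- E] == n.*2.-1.
  by rewrite size_map size_sort -cardE cardC1 card_prod card_ord card_bool muln2.
have memE e : (e \in E) = (e != (k, true)) by rewrite mem_sort mem_enum.
exists (Tuple szE).
  have cE i : count_mem i (Tuple szE) = #|[set e | (e != (k, true)) && (e.1 == i)]|.
    rewrite /= count_map (permP (permEl (perm_sort _ _))) count_enum.
    by apply: eq_card => e; rewrite !inE.
  exists k; split=> [|i ik]; rewrite cE.
    rewrite -(cards1 (k, false)); apply: eq_card => -[j c].
    by rewrite !inE /= !xpair_eqE; case: (j == k); case: c.
  rewrite (_ : 2%N = #|[set (i, false); (i, true)]|); last by rewrite cards2 xpair_eqE andbF.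
  apply: eq_card => -[j c].
  rewrite !inE /= !xpair_eqE; have [->|_] := eqVneq j i; rewrite ?andbF//.
  by rewrite (negPf ik); case: c.
apply/fintype.subsetP => v vs; rewrite in_setU1; have [//|v1 /=] := eqVneq v (corner 1).
pose p (e : 'I_n * bool) := (e.2 < v e.1)%N.
have [tE dE] : take (count p E) E = filter p E /\ drop (count p E) E = filter (predC p) E.
  apply: (sorted_take_filter (r := fun e e' => rk e <= rk e')%N).
  - by move=> ? ? ?; exact: leq_trans.
  - by apply: sort_sorted => e e'; exact: leq_total.
  (* If at [v] the jump [e'] has happened but [e] has not, every member before [e'] lies below [v],
     hence before [e]; and [v] itself separates the two sets. *)
  move=> e e' /[swap] pe'; apply: contraTT; rewrite /p -!leqNgt => pe.
  rewrite -ltnNge; apply: proper_card; apply/properP; split.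
    apply/fintype.subsetP => u; rewrite !inE -andbA => /and3P[u1 us ue']; rewrite u1 us /=.
    apply: leq_trans pe; have /orP[/forallP//|/forallP/(_ e'.1)] := ch _ _ us vs u1 v1.
    by rewrite leqNgt (leq_ltn_trans ue').
  exists v; first by rewrite !inE v1 vs.
  by rewrite !inE v1 vs /= -ltnNge.
rewrite inE; apply/mapP; exists (count p E).
  by rewrite mem_iota add0n (leq_ltn_trans (count_size _ _))// -(size_map fst)
    (eqP szE) ltn_predL double_gt0.
apply/ffunP => i; rewrite ffunE /= -map_take -map_drop tE dE.
have -> : (i \in [seq e.1 | e <- E & p e]) = (0 < v i)%N.
  apply/mapP/idP => [[e]|v0]; first by rewrite mem_filter => /andP[pe _] ->; exact: leq_ltn_trans pe.
  by exists (i, false); rewrite ?mem_filter ?memE /p/= ?v0// xpair_eqE andbF.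
have -> : (i \in [seq e.1 | e <- E & predC p e]) = (v i <= 1)%N.
  apply/mapP/idP => [[e]|vi].
    by rewrite mem_filter /= /p -leqNgt => /andP[pe _] ->; apply: leq_trans pe _; case: e.2.
  have [ik|ik] := eqVneq i k; last first.
    by exists (i, true); rewrite ?mem_filter ?memE /= /p/= -?leqNgt ?vi// xpair_eqE (negPf ik).
  (* The pair [(k, true)] being omitted, [(k, false)] replaces it: [v k] is not 1, so it is 0. *)
  exists (i, false); rewrite // mem_filter memE xpair_eqE andbF andbT /= /p /= -leqNgt.
  by move: vi (kP _ vs v1); rewrite -ik; case: (I3P (v i)) => ->.
by case: (I3P (v i)) => ->.
Qed.

End Bipermutations.

(** * The isomorphism *)

Section BipermutahedralFan.
Context {R : realType} {n : nat}.
Implicit Types (u v : vert n) (b : (n.*2.-1).-tuple 'I_n) (m : nat).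

Local Notation W := (Nspace R n * Nspace R n)%type.
Local Notation gen := (@gen R n).
Local Notation ray := (@ray R n).

Lemma gen_stage b m : bipermutation b ->
  gen (stage b m) = evec R [set i in take m b] + fvec R [set i in drop m b].
Proof.
move=> bb; rewrite /gen.
by congr (evec R _ + fvec R _); apply/setP => i; rewrite !inE ?stage_take ?stage_drop.
Qed.

(* If position [p] (counted from 0) is the first occurrence of [i] in [b], this
   is the difference of the coordinates [k] and [i] in the first factor; if it
   is the second one, that of [i] and [k] in the second factor. *)
Lemma step_functional b k p : bipermutation b -> count_mem k b = 1%N ->
    (p < n.*2.-1)%N ->
  exists l : {scalar W}, forall m, l (gen (stage b m)) = (m <= p)%:R - (k \in drop m b)%:R.
Proof.
move=> bb bk pn; pose i := nth k b p.
have bE : tval b = take p b ++ i :: drop p.+1 b.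
  by rewrite -drop_nth ?size_tuple// cat_take_drop.
have [ip|ip] := boolP (i \in take p b).
  have iD : i \notin drop p.+1 b.
    have : (count_mem i (take p b ++ i :: drop p.+1 b) <= 2)%N.
      by rewrite -bE; exact: count_bipermutation.
    rewrite count_cat /= eqxx add1n addnS ltnS => h.
    rewrite -has_pred1 has_count in ip; rewrite -has_pred1 has_count -leqNgt.
    by have := leq_trans (leq_add ip (leqnn _)) h; rewrite add1n ltnS.
  exists (diff i k \o snd) => m; rewrite -[LHS]/(diff i k (gen (stage b m)).2) genE
    diff_indic !inE !stage_drop//.
  congr (_%:R - _); congr nat_of_bool; apply/idP/idP => [|mp].
    apply: contraLR; rewrite -ltnNge => pm; apply: contra iD.
    by rewrite -(subnK pm) -drop_drop; exact: mem_drop.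
  have -> : i = nth k (drop m b) (p - m) by rewrite nth_drop subnKC.
  by rewrite mem_nth// size_drop size_tuple ltn_sub2r// (leq_ltn_trans mp).
exists (diff k i \o fst) => m; rewrite -[LHS]/(diff k i (gen (stage b m)).1) genE
  diff_indic !inE !stage_take.
rewrite stage_count1//.
have -> : (i \in take m b) = (p < m)%N.
  apply/idP/idP => [|pm].
    apply: contraLR; rewrite -leqNgt => mp; apply: contra ip.
    by rewrite -(take_takel b mp); exact: mem_take.
  rewrite /i -(nth_take k pm) mem_nth// size_take size_tuple.
  by case: ifP.
by rewrite [(m <= p)%N]leqNgt; case: (k \in _); case: (p < m)%N => /=; rewrite ?subrr ?subr0 ?sub0r.
Qed.

Lemma biperm_raysP b g : bipermutation b ->
  g \in biperm_rays R b <->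
  exists2 v, v \in stages b /\ (forall j, v != corner j) & g = gen v.
Proof.
move=> bb; split=> [/imfsetP[m /= mn ->]|[v [vb vn] ->]].
  exists (stage b m); last by rewrite gen_stage.
  by apply: inner_stageP => //; move: mn; rewrite mem_iota; lia.
have [m mn ->] := inner_stage bb vb vn; rewrite gen_stage//.
by apply/imfsetP; exists m => //=; rewrite mem_iota; lia.
Qed.

(** Subtracting the step functionals at [m.-1] and [m] cancels the terms in [k] and leaves the
    indicator of the [m]-th stage. *)
Lemma has_dual_biperm_rays b : bipermutation b -> has_dual (biperm_rays R b).
Proof.
move=> bb; have [k [bk _]] := bb.
have dual m : (0 < m < n.*2.-1)%N -> exists l : {scalar W},
    forall m', l (gen (stage b m')) = (m == m')%:R.
  move=> /andP[m0 mn]; have [l1 l1E] := step_functional bb bk mn.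
  have [|l2 l2E] := @step_functional b k m.-1 bb bk; first by lia.
  exists (l1 \- l2) => m' /=; rewrite l1E l2E opprB addrA subrK -[(m' <= m.-1)%N]ltnS prednK//.
  by rewrite [m == m']eq_sym; case: (ltngtP m' m); rewrite ?subrr ?subr0.
have inj m m' : (0 < m < n.*2.-1)%N -> gen (stage b m) = gen (stage b m') -> m = m'.
  move=> /dual[l lE] e; have := lE m; rewrite e lE eqxx => /eqP.
  by rewrite eqr_nat eqb1 => /eqP.
move=> g /(biperm_raysP _ bb)[v [vb vn] ->]; have [m mn ->] := inner_stage bb vb vn.
have [l lE] := dual _ mn; exists l => h /(biperm_raysP _ bb)[w [wb wn] ->].
have [m' mn' ->] := inner_stage bb wb wn; rewrite lE; congr (_%:R); congr nat_of_bool.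
by apply/eqP/eqP => [->//|]; exact: inj.
Qed.

Lemma biperm_fanP (C : set W) : biperm_fan R n C <->
  exists2 b, bipermutation b & exists2 H, (H `<=` biperm_rays R b)%fset & C = cone H.
Proof.
split=> -[b bb]; first by move/(dual_faceP _ (has_dual_biperm_rays bb)); exists b.
by move=> h; exists b => //; apply/dual_faceP => //; exact: has_dual_biperm_rays.
Qed.

Lemma special1 v : v != corner 1 -> special [set v].
Proof.
move=> v1; split; last by move=> u w /set1P-> /set1P->; rewrite lev_refl.
have /existsP[k kv] : [exists k, v k != 1].
  apply: contraR v1 => /existsPn h; apply/eqP/ffunP => i.
  by rewrite ffunE; apply/eqP/negPn/h.
by exists k => u /set1P->.
Qed.

Lemma special_stagesP (s : {set vert n}) : (0 < n)%N -> special s ->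
  exists2 b, bipermutation b &
    forall v, v \in s -> (forall j, v != corner j) -> gen v \in biperm_rays R b.
Proof.
move=> n0 /(special_bipermutation n0)[b bb /fintype.subsetP sb]; exists b => // v vs vn.
apply/biperm_raysP => //; exists v => //; split=> //.
by have := sb _ vs; rewrite in_setU1 (negPf (vn 1)).
Qed.

(** A nonconstant vertex alone is a special set, so some bipermutation passes through it. *)
Lemma fan_rayP (r : set W) : (0 < n)%N ->
  is_ray r /\ biperm_fan R n r <-> exists2 v, forall j, v != corner j & r = ray v.
Proof.
move=> n0; split=> [[rr [b bb rb]]|[v vn ->]].
  have [g /(biperm_raysP _ bb)[v [_ vn] ->] ->] :
      exists2 g, g \in biperm_rays R b & r = cone [fset g]%fset.
    by apply/dual_rayP => //; exact: has_dual_biperm_rays.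
  by exists v.
have [b bb vb] := special_stagesP n0 (special1 (vn 1)).
have {}vb := vb v (set11 v) vn.
have [] : is_ray (ray v) /\ cone_face (ray v) (cone (biperm_rays R b)).
  by apply/dual_rayP; [exact: has_dual_biperm_rays|exists (gen v)].
by split=> //; exists b.
Qed.

Lemma corner_inj : (0 < n)%N -> injective (@corner n).
Proof. by move=> n0 i j /ffunP/(_ (Ordinal n0)); rewrite !ffunE. Qed.

Definition cone_vertex v : set W + 'I_3 :=
  if [pick j | v == corner j] is Some j then inr j else inl (ray v).

Lemma cone_vertex_corner j : (0 < n)%N -> cone_vertex (corner j) = inr j.
Proof.
move=> n0; rewrite /cone_vertex; case: pickP => [i /eqP/(corner_inj n0)->//|/(_ j)].
by rewrite eqxx.
Qed.

Lemma cone_vertex_ray v : (forall j, v != corner j) -> cone_vertex v = inl (ray v).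
Proof. by move=> vn; rewrite /cone_vertex; case: pickP => // j; rewrite (negPf (vn j)). Qed.

Lemma cornerP v : (forall j, v != corner j) \/ exists j, v = corner j.
Proof.
have [/existsP[j /eqP->]|/existsPn h] := boolP [exists j, v == corner j]; last by left.
by right; exists j.
Qed.

Lemma cone_vertex_inj : (0 < n)%N -> injective cone_vertex.
Proof.
move=> n0 v w; have [vn|[j ->]] := cornerP v; have [wn|[j' ->]] := cornerP w.
- rewrite (cone_vertex_ray vn) (cone_vertex_ray wn) => h; exact: (ray_inj vn (inl_inj h)).
- by rewrite (cone_vertex_ray vn) cone_vertex_corner.
- by rewrite (cone_vertex_ray wn) cone_vertex_corner.
- by rewrite !cone_vertex_corner// => h; rewrite (inr_inj h).
Qed.

Lemma tri_vertices_simplices : (0 < n)%N ->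
  tri_vertices (@simplices R n) = range (@mx R n).
Proof.
move=> n0; apply/seteqP; split=> [_ [_ /simplicesP[s _ ->] /mxsP[v _ ->]]|_ [v _ <-]].
  by exists v.
exists (mxs [set v]); last by rewrite mem_mxs set11.
apply/simplicesP; exists [set v] => //.
have [->|] := eqVneq v (corner 1); last exact: special1.
split; last by move=> u w /set1P-> /set1P->; rewrite eqxx.
by exists (Ordinal n0) => u /set1P->; rewrite eqxx.
Qed.

Lemma tri_faces_simplices (s : {set vert n}) :
  tri_faces (@simplices R n) [set` @mxs R n s]%classic <-> special s.
Proof.
split=> [[S /simplicesP[t tsp ->] e]|sp]; last first.
  by exists (mxs s) => //; apply/simplicesP; exists s.
suff -> : s = t by [].
apply/setP => v; rewrite -!(mem_mxs (R := R)); move: e => /seteqP[st ts].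
by apply/idP/idP => [/st|/ts].
Qed.

Lemma corner_stages b j : bipermutation b -> corner j \in corner 1 |: stages b.
Proof.
move=> bb; have n0 := bipermutation_gt0 bb.
case: (I3P j) => ->; rewrite in_setU1 ?eqxx// orbC inE; apply/orP; left; apply/mapP.
  by exists 0%N; rewrite ?stage0// mem_iota double_gt0.
by exists n.*2.-1; rewrite ?stage_last// mem_iota; lia.
Qed.

(** A cone of the fan uses rays of a single bipermutation, whose stages together with [corner 1] are
    special. Conversely the nonconstant members of [s] span the cone and the constant ones give the
    cone points. *)
Lemma triple_cone_facesP (s : {set vert n}) : (0 < n)%N ->
  triple_cone_faces (biperm_fan R n) (cone_vertex @` [set` s])%classic <-> special s.
Proof.
move=> n0; split=> [[C [A [/biperm_fanP[b bb [H Hb ->]]]]]|sp].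
  have dH := has_dual_sub Hb (has_dual_biperm_rays bb).
  rewrite rays_of_dual// => e; apply: special_sub (special_stages bb).
  apply/fintype.subsetP => v vs; have [vn|[j ->]] := cornerP v; last exact: corner_stages.
  have : (cone_vertex @` [set` s])%classic (inl (ray v)).
    by exists v => //; rewrite cone_vertex_ray.
  rewrite e => -[[r [g gH rE] rv]|[a _ rv]]; last by discriminate rv.
  have /(biperm_raysP _ bb)[w [wb wn] gw] := fsubsetP Hb _ gH.
  (* Since [w] is nonconstant, [ray_inj] identifies it with [v], which is therefore a stage of
     [b]. *)
  have wv : ray w = ray v by rewrite -(inl_inj rv) -rE gw.
  by rewrite -(ray_inj wn wv) in_setU1 wb orbT.
have [b bb sb] := special_stagesP n0 sp.
pose H := [fset gen v | v in [set v in s | [forall j, v != corner j]]]%fset.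
have HP g : g \in H <-> exists2 v, v \in s /\ (forall j, v != corner j) & g = gen v.
  split=> [/imfsetP[v /=]|[v [vs vn] ->]].
    by rewrite inE => /andP[vs /forallP vn] ->; exists v.
  by apply/imfsetP; exists v => //=; rewrite inE vs; apply/forallP.
have Hb : (H `<=` biperm_rays R b)%fset.
  by apply/fsubsetP => g /HP[v [vs vn] ->]; exact: sb.
exists (cone H), [set j | corner j \in s]%classic; split.
  by apply/biperm_fanP; exists b => //; exists H.
rewrite rays_of_dual; last exact: has_dual_sub (has_dual_biperm_rays bb).
apply/seteqP; split=> [_ [v vs <-]|_ [[r [g /HP[v [vs vn] ->] <-] <-]|[j js <-]]].
- have [vn|[j vj]] := cornerP v.
    rewrite cone_vertex_ray//; left; exists (ray v) => //; exists (gen v) => //.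
    by apply/HP; exists v.
  by rewrite vj cone_vertex_corner//; right; exists j => //=; rewrite -vj.
- by exists v => //; rewrite cone_vertex_ray.
- by exists (corner j) => //; rewrite cone_vertex_corner.
Qed.

Lemma simplices_iso : (0 < n)%N ->
  complex_iso (tri_vertices (@simplices R n)) (tri_faces (@simplices R n))
    (triple_cone_vertices (biperm_fan R n)) (triple_cone_faces (biperm_fan R n)).
Proof.
move=> n0; rewrite (tri_vertices_simplices n0); exists (cone_vertex \o @unmx R n).
have unmxE v : (cone_vertex \o @unmx R n) (mx v) = cone_vertex v by rewrite /= mxK.
split.
  split.
  - move=> _ [v _ <-]; rewrite unmxE.
    have [vn|[j ->]] := cornerP v; last by rewrite cone_vertex_corner.
    rewrite cone_vertex_ray//.
    exact: (fan_rayP (ray v) n0).2 (ex_intro2 _ _ v vn erefl).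
  - move=> _ _ /set_mem[v _ <-] /set_mem[w _ <-]; rewrite !unmxE => vw.
    by rewrite (cone_vertex_inj n0 vw).
  - move=> [r rS|j _].
      have [v vn rE] := (fan_rayP r n0).1 rS.
      by exists (mx v); [exists v|rewrite unmxE cone_vertex_ray// rE].
    by exists (mx (corner j)); [exists (corner j)|rewrite unmxE cone_vertex_corner].
(* An arbitrary set of vertices of the complex is the image under [mx] of a finite set, to which the
   two characterisations of faces apply. *)
move=> S SV; pose s := [set v | `[< S (@mx R n v) >]].
have sE : S = [set` @mxs R n s]%classic.
  apply/seteqP; split=> [x Sx|_ /mxsP[v + ->]]; last by rewrite inE => /asboolP.
  have [v _ vx] := SV _ Sx; apply/mxsP; exists v => //.
  by rewrite inE; apply/asboolP; rewrite vx.
have fE : ((cone_vertex \o @unmx R n) @` S = cone_vertex @` [set` s])%classic.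
  rewrite sE; apply/seteqP; split=> [_ [_ /mxsP[v vs ->] <-]|_ [v vs <-]].
    by exists v; [exact: vs|rewrite unmxE].
  by exists (mx v); [exact/mxsP/(ex_intro2 _ _ v vs)|rewrite unmxE].
rewrite fE {1}sE; apply: (iff_trans (tri_faces_simplices s)).
exact: iff_sym (triple_cone_facesP s n0).
Qed.

End BipermutahedralFan.

Theorem theorem5p1 (R : realType) (n : nat) (n_ge2 : (2 <= n)%N) :
  exists K : {fset {fset 'M[R]_(3, n)}},
    triangulation (triangle_power R n) K /\
    unimodular (triangle_power R n) K /\
    complex_iso (tri_vertices K) (tri_faces K)
                (triple_cone_vertices (biperm_fan R n))
                (triple_cone_faces (biperm_fan R n)).
Proof.
have n0 : (0 < n)%N by exact: ltnW.
exists simplices; split; first exact: simplices_triangulation.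
by split; [exact: simplices_unimodular|exact: simplices_iso].
Qed.
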